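(* Let Assumptions 0, 1, 2, 3 (see context) hold, let $F^h$ be a linear functional on $\mathcal U_h(\mathcal L)$ with $\langle F^h,1\rangle_h=0$, and let $\mathcal I_h^*F^h\in\mathcal U(\mathcal L)$ be defined by $\langle\mathcal I_h^*F^h,v\rangle_{\mathcal L}=\langle F^h,\mathcal I_hv\rangle_h$ for all $v\in\mathcal U(\mathcal L)$. Then the coarse-grained problem $$\text{find }u\in\mathcal U_{h,\#}(\mathcal L):\qquad\langle\delta E^0(u),v_h\rangle_{\mathcal L}=\langle F^h,v_h\rangle_h\quad\forall v_h\in\mathcal U_{h,\#}(\mathcal L)$$ is equivalent to the (fully atomistic) problem $$\text{find }u\in\mathcal U_\#(\mathcal L):\qquad\langle\delta E^0(u),v\rangle_{\mathcal L}=\langle\mathcal I_h^*F^h,v\rangle_{\mathcal L}\quad\forall v\in\mathcal U_\#(\mathcal L),$$ i.e. a function $u$ with $|Du(x)|<\rho_z$ for all $x$ solves the first problem if and only if it solves the second.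
   Context: Lattices. Fix positive integers $p$, $R$ and a positive multiple $N$ of $p$; $\epsilon=1/N$, $\mathcal L=\{\epsilon,2\epsilon,\dots,N\epsilon\}$, $\mathcal P=\{1,\dots,p\}$. $\mathcal U(\mathcal L)$ is the space of functions $u:\epsilon\mathbb Z\to\mathbb R$ with $u(x+1)=u(x)$ (note $\epsilon N=1$); $\langle u\rangle_{\mathcal L}=\frac1N\sum_{x\in\mathcal L}u(x)$, $\langle u,v\rangle_{\mathcal L}=\langle uv\rangle_{\mathcal L}$, $\mathcal U_\#(\mathcal L)=\{u\in\mathcal U(\mathcal L):\langle u\rangle_{\mathcal L}=0\}$. $Du(x)=\frac{u(x+\epsilon)-u(x)}{\epsilon}$. Likewise $\mathcal U(\mathcal P)$ is the space of $p$-periodic functions $\mathbb Z\to\mathbb R$, $\langle\eta\rangle_{\mathcal P}=\frac1p\sum_{y=1}^p\eta(y)$, $\mathcal U_\#(\mathcal P)$ its zero-mean subspace, $D_{y,r}\eta(y)=\frac{\eta(y+r)-\eta(y)}{r}$, and on $\mathcal U(\mathcal P)$ $|\eta|_{1,\infty}=\max_y|D_{y,1}\eta(y)|$. Potentials. For $1\le r\le R$ and $y\in\mathbb Z$ ($p$-periodically in $y$) $\Phi_r(\cdot;y)$ is a real function of one real variable on an open interval; $\delta\Phi_r,\delta^2\Phi_r$ are its first and second derivatives in that variable. Assumptions. There are $\chi_*\in\mathcal U_\#(\mathcal P)$ and $\rho_\Phi>0$ with: (0) $y\mapsto y+\chi_*(y)$ is strictly increasing on $\mathbb Z$. (1) For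 all $r,y$, $\Phi_r(\cdot;y)$ is defined on the interval of radius $\rho_\Phi$ about $D_{y,r}\chi_*(y)$ and is $C^{2,1}$ there (second derivative Lipschitz). (2) $\sum_{r=1}^R\langle\delta\Phi_r(D_{y,r}\chi_*(y);y),D_{y,r}\eta(y)\rangle_{y\in\mathcal P}=0$ for all $\eta\in\mathcal U_\#(\mathcal P)$. (3) $\frac12\min_y\delta^2\Phi_1(D_{y,1}\chi_*(y);y)-\sum_{r=2}^R\max_y|\delta^2\Phi_r(D_{y,r}\chi_*(y);y)|>0$. Homogenization. $\rho_z,\rho_\chi>0$ are fixed, sufficiently small, so that for $|z|<\rho_z$ there is a unique $\chi(z)=\chi(z;\cdot)\in\mathcal U_\#(\mathcal P)$ with $|\chi(z)-\chi_*|_{1,\infty}<\rho_\chi$ and $\sum_{r=1}^R\langle\delta\Phi_r(z+D_{y,r}\chi(z;y);y),D_{y,r}\eta(y)\rangle_{y\in\mathcal P}=0$ for all $\eta\in\mathcal U_\#(\mathcal P)$. The homogenized potential $\Phi^0(z)=\sum_{r=1}^R\langle\Phi_r(z+D_{y,r}\chi(z;y);y)\rangle_{y\in\mathcal P}$, $|z|<\rho_z$, is of class $C^2$ and (with $\rho_z$ small enough) $\delta^2\Phi^0(z)\ge c_0>0$ for all $|z|<\rho_z$. $E^0(u)=\langle\Phi^0(Du)\rangle_{\mathcal L}$, so $\langle\delta E^0(u),v\rangle_{\mathcal L}=\langle\delta\Phi^0(Du),Dv\rangle_{\mathcal L}$, defined for $u$ with $|Du(x)|<\rho_z$ for all $x$.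 Mesh. $\mathcal N_h\subset\mathcal L$ is a nonempty set of nodes, extended $1$-periodically. $\mathcal U_h(\mathcal L)=\{u\in\mathcal U(\mathcal L): Du(\xi-\epsilon)=Du(\xi)\ \forall\xi\in\mathcal L\setminus\mathcal N_h\}$ (functions affine between consecutive nodes), $\mathcal U_{h,\#}(\mathcal L)=\mathcal U_h(\mathcal L)\cap\mathcal U_\#(\mathcal L)$. $\mathcal I_h:\mathcal U(\mathcal L)\to\mathcal U_h(\mathcal L)$ is the nodal interpolant ($\mathcal I_hv=v$ on $\mathcal N_h$). $\langle\cdot,\cdot\rangle_h$ denotes the pairing of linear functionals on $\mathcal U_h(\mathcal L)$ with elements of $\mathcal U_h(\mathcal L)$; a functional $F^h$ given on $\mathcal U_{h,\#}(\mathcal L)$ is extended to $\mathcal U_h(\mathcal L)$ by $\langle F^h,1\rangle_h=0$. *)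

(* Defs.v *)
From mathcomp Require Import all_boot all_order all_algebra.
From mathcomp Require Import all_classical all_reals all_analysis.
Set Implicit Arguments.
Unset Strict Implicit.
Unset Printing Implicit Defensive.
Import Order.TTheory GRing.Theory Num.Theory.
Import numFieldNormedType.Exports.
Local Open Scope classical_set_scope.
Local Open Scope ring_scope.

(* A function u on the scaled lattice eps Z, eps = 1/N, is encoded by the
   function k |-> u (eps k) on int; 1-periodicity of u is then N-periodicity
   in k. Functions of the microscopic variable y are indexed by y itself, so
   the spaces and averages below serve both lattices (with n = N or n = p). *)
Section PeriodicFunctions.
Variable R : realType.
Implicit Types (n r : nat) (f u : int -> R).

Definition U n : set (int -> R) :=
  [set u | forall k, u (k + n%:Z) = u k].

Definition avg n f : R := n%:R^-1 * \sum_(1 <= k < n.+1) f k%:Z.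

Definition U_zero_mean n : set (int -> R) := [set u | U n u /\ avg n u = 0].

(* f 1 is one of the n >= 1 values over which the extremum is taken. *)
Definition min_period n f : R := \big[Num.min/f 1]_(1 <= k < n.+1) f k%:Z.
Definition max_period n f : R := \big[Num.max/f 1]_(1 <= k < n.+1) f k%:Z.

Definition Dy r f (y : int) : R := (f (y + r%:Z) - f y) / r%:R.

Definition norm1oo n f : R := max_period n (fun y => `|Dy 1 f y|).

(* (u (x + eps) - u x) / eps at x = eps k *)
Definition D N u (k : int) : R := (u (k + 1) - u k) / N%:R^-1.

End PeriodicFunctions.

(* Phi r y s stands for Phi_r(s; y). Phi is total here: its values at s outside
   the interval of radius rhoPhi about D_{y,r} chis(y) carry no meaning. *)
Section Potentials.
Variables (R : realType) (p nR : nat) (Phi : nat -> int -> R -> R).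
Implicit Types (chis : int -> R) (chi : R -> int -> R).

Definition site_periodic : Prop :=
  forall r y s, (1 <= r <= nR)%N -> Phi r (y + p%:Z) s = Phi r y s.

(* The cell equilibrium equation at strains g r y; these are D_{y,r} chis(y)
   in the reference state and z + D_{y,r} eta(y) in the corrector problem. *)
Definition stationary (g : nat -> int -> R) : Prop :=
  forall eta, U_zero_mean p eta ->
  \sum_(1 <= r < nR.+1)
    avg p (fun y => derive1 (Phi r y) (g r y) * Dy r eta y) = 0.

Definition assumption0 chis : Prop :=
  forall y1 y2 : int, (y1 < y2) -> y1%:~R + chis y1 < y2%:~R + chis y2.

Definition assumption1 chis (rhoPhi : R) : Prop :=
  forall r y, (1 <= r <= nR)%N ->
  let I := [set s : R | `|s - Dy r chis y| < rhoPhi] in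
  [/\ forall s, I s -> derivable (Phi r y) s 1,
      forall s, I s -> derivable (derive1 (Phi r y)) s 1 &
      [lipschitz derive1n 2 (Phi r y) s | s in I]].

Definition assumption2 chis : Prop := stationary (fun r y => Dy r chis y).

Definition assumption3 chis : Prop :=
  0 < 2^-1 * min_period p (fun y => derive1n 2 (Phi 1 y) (Dy 1 chis y))
      - \sum_(2 <= r < nR.+1)
          max_period p (fun y => `|derive1n 2 (Phi r y) (Dy r chis y)|).

(* The radii are small enough for the potentials to be evaluated only where
   assumption1 controls them. *)
Definition radii_in_domain chis (rhoPhi rhoz rhochi : R) : Prop :=
  forall z eta r y, `|z| < rhoz -> U_zero_mean p eta ->
    norm1oo p (fun y => eta y - chis y) < rhochi -> (1 <= r <= nR)%N ->
    `|z + Dy r eta y - Dy r chis y| < rhoPhi.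

Definition is_corrector chis (rhochi z : R) (eta : int -> R) : Prop :=
  [/\ U_zero_mean p eta,
      norm1oo p (fun y => eta y - chis y) < rhochi &
      stationary (fun r y => z + Dy r eta y)].

Definition corrector_map chis (rhoz rhochi : R) chi : Prop :=
  forall z, `|z| < rhoz ->
  is_corrector chis rhochi z (chi z) /\
  forall eta, is_corrector chis rhochi z eta -> eta = chi z.

Definition Phi0 chi (z : R) : R :=
  \sum_(1 <= r < nR.+1) avg p (fun y => Phi r y (z + Dy r (chi z) y)).

Definition E0 chi N (u : int -> R) : R := avg N (fun k => Phi0 chi (D N u k)).

(* < dE0(u), v >_L, as the directional derivative of E0 at u along v *)
Definition dE0 chi N (u v : int -> R) : R :=
  derive1 (fun t : R => E0 chi N (fun k => u k + t * v k)) 0.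

End Potentials.

Definition C2_on (R : realType) (f : R -> R) (rho : R) : Prop :=
  forall z, `|z| < rho ->
  [/\ derivable f z 1, derivable (derive1 f) z 1 &
      {for z, continuous (derive1n 2 f)}].

Section Mesh.
Variables (R : realType) (N : nat) (Nh : set int).
Implicit Types (u v w : int -> R) (F : (int -> R) -> R).

Definition lattice : set int := [set k | 1 <= k <= N%:Z].

Definition U_h : set (int -> R) :=
  [set u | U N u /\
    forall k, (lattice `\` Nh) k -> D N u (k - 1) = D N u k].

Definition U_h_zero_mean : set (int -> R) := U_h `&` U_zero_mean N.

(* Agreement at the nodes in one period suffices, both sides being
   N-periodic. *)
Definition nodal_interpolant (Ih : (int -> R) -> (int -> R)) : Prop :=
  forall v, U N v -> U_h (Ih v) /\ forall k, Nh k -> Ih v k = v k.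

(* F is total; only its values on U_h are meaningful. *)
Definition linear_functional_h F : Prop :=
  forall (a : R) u v, U_h u -> U_h v ->
    F (fun k => a * u k + v k) = a * F u + F v.

Definition interpolant_adjoint (Ih : (int -> R) -> (int -> R)) F IhF : Prop :=
  U N IhF /\ forall v, U N v -> avg N (fun k => IhF k * v k) = F (Ih v).

End Mesh.

Section Problems.
Variables (R : realType) (p nR N : nat) (Phi : nat -> int -> R -> R).
Variables (chi : R -> int -> R) (Nh : set int).

Definition coarse_solution (F : (int -> R) -> R) (u : int -> R) : Prop :=
  U_h_zero_mean N Nh u /\
  forall v, U_h_zero_mean N Nh v -> dE0 p nR Phi chi N u v = F v.

Definition atomistic_solution (f u : int -> R) : Prop :=
  U_zero_mean N u /\
  forall v, U_zero_mean N v ->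
    dE0 p nR Phi chi N u v = avg N (fun k => f k * v k).

End Problems.

(* Main.v *)
(* The derivative of E0 at u along v is the average of sigma(Du) Dv, with sigma
   the derivative of Phi0. If u is affine between nodes, summation by parts
   shows that sigma(Du) pairs to 0 with D(v - Ih v), so coarse and atomistic test
   functions carry the same information. Conversely, testing the atomistic
   equation with a delta function at a non-nodal point k gives
   sigma(Du(k-1)) = sigma(Du(k)), and sigma is injective by strict convexity of
   Phi0, so an atomistic solution is affine between nodes. *)
Require Import Defs.
From mathcomp Require Import all_boot all_order all_algebra.
From mathcomp Require Import all_classical all_reals all_analysis.
From mathcomp Require Import ring lra zify.
Set Implicit Arguments.
Unset Strict Implicit.
Import Order.TTheory GRing.Theory Num.Theory.
Import numFieldNormedType.Exports.
Local Open Scope classical_set_scope.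
Local Open Scope ring_scope.

(** * Averages, summation by parts and delta functions on the periodic lattice *)

Section Periodic.
Variables (R : realType) (N : nat).
Implicit Types (f g u v w : int -> R).

Lemma eq_avg f g : (forall k, lattice N k -> f k = g k) -> avg N f = avg N g.
Proof.
move=> fg; rewrite /avg; congr (_ * _); apply: eq_big_nat => k /andP[k1 kN].
by apply: fg; rewrite /lattice /=; lia.
Qed.

Lemma avgD f g : avg N (fun k => f k + g k) = avg N f + avg N g.
Proof. by rewrite /avg big_split mulrDr. Qed.

Lemma avgZ a f : avg N (fun k => a * f k) = a * avg N f.
Proof. by rewrite /avg -mulr_sumr mulrCA. Qed.

Lemma D_affine a u v : D N (fun k => a * u k + v k) = fun k => a * D N u k + D N v k.
Proof. by apply/funext => k; rewrite /D; lra. Qed.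

Lemma U_mulz u (q : int) k : U N u -> u (k + N%:Z * q) = u k.
Proof.
move=> Uu; elim: q => [|n IH|n IH]; first by rewrite mulr0 addr0.
  by rewrite -IH -[RHS]Uu; congr u; lia.
by rewrite -IH -[LHS]Uu; congr u; lia.
Qed.

Hypothesis N_gt0 : (0 < N)%N.

Lemma avg_cst c : avg N (fun=> c) = c :> R.
Proof.
by rewrite /avg sumr_const_nat subn1 /= -[c *+ N]mulr_natl mulKf // pnatr_eq0 -lt0n.
Qed.

Lemma avg_eq0 f : (forall k, 0 <= f k) -> avg N f = 0 ->
  forall k, lattice N k -> f k = 0.
Proof.
move=> f0 /eqP; rewrite /avg mulf_eq0 invr_eq0 pnatr_eq0 eqn0Ngt N_gt0 /=.
rewrite psumr_eq0 // => /allP f0' k /= kN.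
have /f0'/eqP : `|k|%N \in index_iota 1 N.+1.
  by rewrite mem_index_iota; move: kN; rewrite /lattice /=; lia.
by move=> <-; congr f; move: kN; rewrite /lattice /=; lia.
Qed.

Lemma U_eq u v : U N u -> U N v -> (forall k, lattice N k -> u k = v k) ->
  forall k, u k = v k.
Proof.
move=> Uu Uv uv k.
have N0 : N%:Z != 0 by lia.
(* Dividing [k - 1] instead of [k] puts the representative in 1..N, the range of [lattice N], rather
   than in 0..N-1. *)
have -> : k = ((k - 1) %% N%:Z)%Z + 1 + N%:Z * ((k - 1) %/ N%:Z)%Z.
  by have := divz_eq (k - 1) N; lia.
rewrite !U_mulz //; apply: uv; rewrite /lattice /=.
have := modz_ge0 (k - 1) N0; have := @ltz_pmod (k - 1) N%:Z.
by lia.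
Qed.

Lemma U_affine a u v : U N u -> U N v -> U N (fun k => a * u k + v k).
Proof. by move=> Uu Uv k; rewrite Uu Uv. Qed.

Lemma U_D u : U N u -> U N (D N u).
Proof. by move=> Uu k; rewrite /D addrAC !Uu. Qed.

(** By the discrete product rule the two integrands add up to [N] times the increment of
    [g (k - 1) * w k]; this telescopes over a period, and the end terms agree by periodicity. *)
Lemma avg_by_parts g w : U N g -> U N w ->
  avg N (fun k => g k * D N w k) = - avg N (fun k => D N g (k - 1) * w k).
Proof.
move=> Ug Uw; apply/eqP; rewrite -subr_eq0 opprK -avgD /avg.
have E k : g k * D N w k + D N g (k - 1) * w k =
    N%:R * (g k * w (k + 1) - g (k - 1) * w k).
  by rewrite /D invrK subrK; ring.
under eq_bigr do rewrite E.
rewrite -mulr_sumr.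
have -> : \sum_(1 <= k < N.+1) (g k * w (k%:Z + 1) - g (k%:Z - 1) * w k) =
    \sum_(1 <= k < N.+1) (g (k.+1%:Z - 1) * w k.+1 - g (k%:Z - 1) * w k).
  by apply: eq_bigr => k _; congr (g _ * w _ - _); lia.
rewrite (telescope_sumr (fun k : nat => g (k%:Z - 1) * w k)) //.
have -> : N.+1%:Z - 1 = 1 - 1 + N%:Z :> int by lia.
have -> : N.+1%:Z = 1 + N%:Z :> int by lia.
by rewrite Ug Uw subrr !mulr0.
Qed.

Definition periodic_delta (j k : int) : R := (N%:Z %| k - j)%Z%:R.

Lemma U_periodic_delta j : U N (periodic_delta j).
Proof.
move=> k; rewrite /periodic_delta; congr (nat_of_bool _)%:R.
by rewrite addrAC (rpredDr _ (dvdzz N)).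
Qed.

Lemma periodic_deltaE j k : lattice N j -> lattice N k ->
  periodic_delta j k = (k == j)%:R.
Proof.
rewrite /lattice /= => jN kN; congr (nat_of_bool _)%:R.
have [->|kj] := eqVneq k j; first by rewrite subrr dvdz0.
apply/negP => /dvdzP[q kjq].
(* Two points of [lattice N] differ by less than [N], so no nonzero multiple of [N] can be their
   difference. *)
have [q0|[q0|q0]] : q = 0 \/ 1 <= q \/ q <= -1 by lia.
- by move: kj; rewrite -subr_eq0 kjq q0 mul0r eqxx.
- have : N%:Z <= q * N%:Z by rewrite ler_peMl.
  by lia.
- have : N%:Z <= - q * N%:Z by rewrite ler_peMl //; lia.
  by lia.
Qed.

Lemma avg_mul_delta f j : lattice N j ->
  avg N (fun k => f k * periodic_delta j k) = N%:R^-1 * f j.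
Proof.
move=> jN; have jN' := jN; rewrite /lattice /= in jN'.
rewrite /avg; congr (_ * _).
have jj : `|j|%N \in index_iota 1 N.+1 by rewrite mem_index_iota; lia.
have jE : `|j|%N%:Z = j by lia.
rewrite (bigD1_seq `|j|%N) ?iota_uniq //= jE periodic_deltaE // eqxx mulr1.
rewrite big_seq_cond big1 ?addr0 // => k /andP[]; rewrite mem_index_iota => kN kj.
have kj' : (k%:Z == j) = false by lia.
have kN' : lattice N k by rewrite /lattice /=; lia.
by rewrite periodic_deltaE // kj' mulr0.
Qed.

End Periodic.

(** * Functions affine between nodes *)

Section Interpolation.
Variables (R : realType) (N : nat) (Nh : set int).
Hypothesis N_gt0 : (0 < N)%N.
Implicit Types (u v w : int -> R).

Lemma U_h_affine a u v : U_h N Nh u -> U_h N Nh v ->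
  U_h N Nh (fun k => a * u k + v k).
Proof.
move=> [Uu hu] [Uv hv]; split; first exact: U_affine.
by move=> k kN; rewrite D_affine hu // hv.
Qed.

Lemma U_h_cst c : U_h N Nh (fun=> c : R).
Proof. by split=> // k _; rewrite /D subrr. Qed.

(** After summation by parts every term vanishes: at a node through [w], elsewhere because [D N u],
    hence [s (D N u)], does not jump. The choice [s = id] gives uniqueness of interpolants, and
    [s = derive1 W] compares the two problems. *)
Lemma avg_stress_nodal0 (s : R -> R) u w : U_h N Nh u -> U N w ->
  (forall k, Nh k -> w k = 0) -> avg N (fun k => s (D N u k) * D N w k) = 0.
Proof.
move=> [Uu hu] Uw w0.
have Us : U N (fun k => s (D N u k)) by move=> k; rewrite U_D.
rewrite avg_by_parts // (@eq_avg _ _ _ (fun=> 0)) ?avg_cst ?oppr0 // => k kN.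
have [/w0 ->|kNh] := pselect (Nh k); first by rewrite mulr0.
by rewrite {1}/D subrK hu // subrr !mul0r.
Qed.

Hypothesis Nh_nonempty : Nh !=set0.

(* The energy avg (D w)^2 of the difference w of two interpolants vanishes. *)
Lemma U_h_nodal_inj u v : U_h N Nh u -> U_h N Nh v ->
  (forall k, Nh k -> u k = v k) -> u = v.
Proof.
move=> hu hv uv.
pose w k := -1 * v k + u k.
have hw : U_h N Nh w by apply: U_h_affine.
have Uw : U N w by case: hw.
have w0 k : Nh k -> w k = 0 by move=> /uv; rewrite /w => ->; lra.
have Dw0 k : D N w k = 0.
  apply: (@U_eq _ N N_gt0 _ (fun=> 0)) => //; first exact: U_D.
  move=> j jN; have := avg_stress_nodal0 id hw Uw w0.
  move=> /(avg_eq0 N_gt0) => /(_ (fun k => sqr_ge0 _) _ jN) /eqP.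
  by rewrite mulf_eq0 orbb => /eqP.
have wS k : w (k + 1) = w k.
  move: (Dw0 k) => /eqP; rewrite /D invrK mulf_eq0 pnatr_eq0 (gtn_eqF N_gt0) orbF.
  by rewrite subr_eq0 => /eqP.
have wc k q : w (k + q) = w k.
  elim: q => [|n IH|n IH]; first by rewrite addr0.
    by rewrite -IH -[RHS]wS; congr w; lia.
  by rewrite -IH -[LHS]wS; congr w; lia.
(* [w] is constant by now; a single node fixes the constant to be 0. *)
apply/funext => k; have [j /w0 wj] := Nh_nonempty.
have : w k = 0 by rewrite -wj -(wc j (k - j)); congr w; lia.
by rewrite /w; lra.
Qed.

End Interpolation.

(** * Injectivity of the stress and the first variation of the energy *)

Lemma derive1_gt0_inj (R : realType) (f : R -> R) (rho : R) :
  (forall z, `|z| < rho -> derivable f z 1) ->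
  (forall z, `|z| < rho -> 0 < derive1 f z) ->
  forall x y, `|x| < rho -> `|y| < rho -> f x = f y -> x = y.
Proof.
move=> df f'0.
suff inj x y : `|x| < rho -> `|y| < rho -> x < y -> f x != f y.
  move=> x y xr yr fxy; case: (ltgtP x y) => // xy.
    by move: (inj _ _ xr yr xy); rewrite fxy eqxx.
  by move: (inj _ _ yr xr xy); rewrite fxy eqxx.
move=> xr yr xy.
have zr z : x <= z <= y -> `|z| < rho.
  by move: xr yr; rewrite !ltr_norml; lra.
have [| |z zxy fyx] := @MVT _ f (derive1 f) x y xy.
- move=> z zxy; rewrite derive1E; apply: derivableP; apply: df; apply: zr.
  by move: zxy; rewrite in_itv /=; lra.
- apply: derivable_within_continuous => z; rewrite in_itv /= => /zr; exact: df.
have := f'0 z (zr z _); rewrite in_itv /= in zxy => /(_ _) f'z.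
have {}f'z : 0 < derive1 f z by apply: f'z; lra.
have : 0 < f y - f x by rewrite fyx mulr_gt0 // subr_gt0.
by rewrite subr_gt0 => /lt_eqF ->.
Qed.

(** Chain rule in a finite sum, along strains affine in [t]. As the derivative is taken at [t = 0],
    [Phi0] is differentiated exactly at the strains [D N u k], whatever the size of [v]. *)
Lemma dE0E (R : realType) (p nR N : nat) (Phi : nat -> int -> R -> R)
    (chi : R -> int -> R) (rho : R) (u v : int -> R) :
  (forall z, `|z| < rho -> derivable (Phi0 p nR Phi chi) z 1) ->
  (forall k, `|D N u k| < rho) ->
  dE0 p nR Phi chi N u v =
  avg N (fun k => derive1 (Phi0 p nR Phi chi) (D N u k) * D N v k).
Proof.
move=> dPhi ur; rewrite /dE0 /E0; set W := Phi0 p nR Phi chi.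
have -> : (fun t => avg N (fun k => W (D N (fun k => u k + t * v k) k))) =
   (fun t => N%:R^-1 * \sum_(1 <= k < N.+1) W (D N u k + t * D N v k)).
  apply/funext => t; rewrite /avg; congr (_ * _); apply: eq_bigr => k _.
  by congr W; rewrite /D; lra.
have dW (k : int) : is_derive (0 : R) (1 : R) (fun t => W (D N u k + t * D N v k))
    (derive1 W (D N u k) * D N v k).
  have WD : is_derive (D N u k + 0 * D N v k) (1 : R) W (derive1 W (D N u k)).
    by rewrite mul0r addr0 derive1E; apply: derivableP; exact: dPhi.
  have LD : is_derive (0 : R) (1 : R) (fun t => D N u k + t * D N v k) (D N v k).
    by apply: is_derive_eq; rewrite /GRing.scale /=; ring.
  have := @is_derive1_comp _ W (fun t => D N u k + t * D N v k) _ _ _ WD LD.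
  by rewrite /GRing.scale /=.
rewrite derive1E /avg big_add1 big_mkord; apply: derive_val.
have -> : (fun t => N%:R^-1 * \sum_(1 <= k < N.+1) W (D N u k + t * D N v k)) =
    N%:R^-1 *: \sum_(k < N) (fun t => W (D N u k.+1 + t * D N v k.+1)).
  by apply/funext => t; rewrite big_add1 big_mkord /= fct_sumE.
exact: is_deriveZ.
Qed.

Theorem lemma4p1 (R : realType) (p nR N : nat)
  (p_gt0 : (0 < p)%N) (nR_gt0 : (0 < nR)%N) (N_gt0 : (0 < N)%N)
  (p_dvd_N : (p %| N)%N)
  (Phi : nat -> int -> R -> R) (Phi_per : site_periodic p nR Phi)
  (chis : int -> R) (chis_mean0 : U_zero_mean p chis)
  (rhoPhi : R) (rhoPhi_gt0 : 0 < rhoPhi)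
  (A0 : assumption0 chis) (A1 : assumption1 nR Phi chis rhoPhi)
  (A2 : assumption2 p nR Phi chis) (A3 : assumption3 p nR Phi chis)
  (rhoz rhochi : R) (rhoz_gt0 : 0 < rhoz) (rhochi_gt0 : 0 < rhochi)
  (rho_small : radii_in_domain p nR chis rhoPhi rhoz rhochi)
  (chi : R -> int -> R)
  (chiP : corrector_map p nR Phi chis rhoz rhochi chi)
  (Phi0_C2 : C2_on (Phi0 p nR Phi chi) rhoz)
  (c0 : R) (c0_gt0 : 0 < c0)
  (Phi0_convex : forall z : R, `|z| < rhoz ->
    c0 <= derive1n 2 (Phi0 p nR Phi chi) z)
  (Nh : set int) (Nh_sub : Nh `<=` lattice N) (Nh_nonempty : Nh !=set0)
  (Ih : (int -> R) -> (int -> R)) (IhP : nodal_interpolant N Nh Ih)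
  (F : (int -> R) -> R) (F_lin : linear_functional_h N Nh F)
  (F_one : F (fun=> 1) = 0)
  (IhF : int -> R) (IhFP : interpolant_adjoint N Ih F IhF) :
  forall u : int -> R, (forall k, `|D N u k| < rhoz) ->
    (coarse_solution p nR N Phi chi Nh F u <->
     atomistic_solution p nR N Phi chi IhF u).
Proof.
move=> u ur.
set W := Phi0 p nR Phi chi in Phi0_C2 Phi0_convex.
have dW z : `|z| < rhoz -> derivable W z 1 by move=> /Phi0_C2[].
have dE v : dE0 p nR Phi chi N u v = avg N (fun k => derive1 W (D N u k) * D N v k).
  exact: dE0E dW ur.
clearbody W.
have F0 : F (fun=> 0) = 0.
  have := F_lin 1 _ _ (U_h_cst N Nh 0) (U_h_cst N Nh 0).
  by rewrite mulr0 addr0; lra.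
have F_cst c : F (fun=> c) = 0.
  have := F_lin c _ _ (U_h_cst N Nh 1) (U_h_cst N Nh 0).
  by rewrite mulr1 addr0 F_one F0 mulr0 addr0.
(* Nodal values determine the interpolant. This computes [Ih] on constants, on [U_h] and on delta
   functions at non-nodal points. *)
have IhE v w : U N v -> U_h N Nh w -> (forall k, Nh k -> v k = w k) -> Ih v = w.
  move=> Uv hw vw; have [hIv Iv] := IhP v Uv.
  by apply: (U_h_nodal_inj N_gt0 Nh_nonempty) => // k /[dup] /Iv -> /vw.
have [UIhF IhFE] := IhFP.
split=> [[[hu Zu] cu]|[Zu au]].
  split=> // v [Uv _]; rewrite IhFE //.
  have [hIv Iv] := IhP v Uv.
  have UIv : U N (Ih v) by case: hIv.
  (* A coarse test function must have zero mean, so the mean of [Ih v] is subtracted; neither [F]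
     nor [D] sees the constant. *)
  pose w k := 1 * Ih v k + - avg N (Ih v).
  have <- : F w = F (Ih v).
    by rewrite F_lin ?F_cst ?mul1r ?addr0 //; exact: U_h_cst.
  have hw : U_h N Nh w by exact/U_h_affine/U_h_cst.
  rewrite -cu; last first.
    split=> //; split; first by case: hw.
    by rewrite avgD avgZ avg_cst // mul1r subrr.
  rewrite !dE; apply/eqP; rewrite -subr_eq0 -mulN1r -avgZ -avgD; apply/eqP.
  (* The right-hand 0 is written as the pairing of the stress with [D] of [v - Ih v], a function
     vanishing at the nodes. *)
  rewrite -(@avg_stress_nodal0 _ _ _ N_gt0 (derive1 W) u
    (fun k => -1 * Ih v k + v k) hu); last 2 first.
  - exact: U_affine.
  - by move=> k /Iv ->; rewrite mulN1r addNr.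
  by apply: eq_avg => k _; rewrite /w /D; ring.
(* The zero-mean constraint on test functions is lifted, since a delta function has nonzero mean.
   Constants contribute nothing: [D] kills them, and [avg N IhF = F (Ih 1) = F 1 = 0]. *)
have {}au v : U N v -> avg N (fun k => derive1 W (D N u k) * D N v k) = F (Ih v).
  move=> Uv; rewrite -IhFE //.
  pose c := avg N v; pose w k := 1 * v k + - c.
  have Zw : U_zero_mean N w.
    split; first exact: U_affine.
    by rewrite avgD avgZ avg_cst // mul1r subrr.
  have IhF0 : avg N IhF = 0.
    rewrite -(F_cst 1) -(IhE (fun=> 1) _ _ (U_h_cst N Nh 1)) // -IhFE //.
    by apply: eq_avg => k _; rewrite mulr1.
  transitivity (avg N (fun k => derive1 W (D N u k) * D N w k)).
    by apply: eq_avg => k _; rewrite /w /D; ring.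
  rewrite -dE au // -[RHS]subr0 -[X in _ - X](mulr0 c) -IhF0 -mulNr -avgZ -avgD.
  by apply: eq_avg => k _; rewrite /w; ring.
have Uu : U N u by case: Zu.
have hu : U_h N Nh u.
  split=> // k [kN kNh].
  have d2W z : `|z| < rhoz -> derivable (derive1 W) z 1.
    by move=> /Phi0_C2[_ d2Wz _]; exact: d2Wz.
  have W2_gt0 z : `|z| < rhoz -> 0 < derive1 (derive1 W) z.
    by move=> zr; exact: lt_le_trans c0_gt0 (Phi0_convex z zr).
  apply: (derive1_gt0_inj d2W W2_gt0 (ur _) (ur _)).
  have := au _ (U_periodic_delta R N k).
  (* The delta function at the non-nodal point [k] vanishes at all nodes, so its interpolant is 0
     and the load term drops out. *)
  rewrite (IhE _ (fun=> 0)) ?F0; first last.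
  - move=> j jNh; rewrite periodic_deltaE //; last exact: Nh_sub.
    by have [jk|//] := eqVneq j k; rewrite -jk in kNh.
  - exact: U_h_cst.
  - exact: U_periodic_delta.
  rewrite avg_by_parts //; last exact: U_periodic_delta.
    rewrite avg_mul_delta // => /eqP; rewrite oppr_eq0 mulf_eq0 invr_eq0 pnatr_eq0.
    rewrite (gtn_eqF N_gt0) /D invrK mulf_eq0 pnatr_eq0 (gtn_eqF N_gt0) orbF subrK.
    by rewrite subr_eq0 => /eqP ->.
  by move=> j; rewrite U_D.
(* A coarse test function is its own interpolant. *)
split=> // v [hv [Uv _]].
by rewrite dE au // (IhE v v).
Qed.
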